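(* Let $C$ be a cyclic $A_\infty$ coalgebra of degree $-d$, $R=\mathbf\Omega_\infty(\tilde C)$, $n=2-d$. Then $\bar\partial:R\to\Omega^1_{R,\natural}$ and $\beta:\Omega^1_{R,\natural}\to R$ are morphisms of Lie modules over $R_\natural$, that is, $$\bar\partial\{r,q\}=\{r,\bar\partial(q)\}_{\Omega^1_{R,\natural}},\qquad\beta\{r,\omega\}_{\Omega^1_{R,\natural}}=\{r,\beta(\omega)\}$$ for $r,q\in R$ and $\omega\in\Omega^1_{R,\natural}$.
   Context: $C$ is a cyclic $A_\infty$ coalgebra of degree $-d$ (graded, locally finite, $\triangle_n:C\to C^{\otimes n}$ of degree $n-2$ with the $A_\infty$ relations, nondegenerate graded-symmetric $\langle-,-\rangle:C\otimes C\to k[d]$ with $\langle a,b^1\rangle b^2\cdots b^r=(-1)^{r+|b^1|(|a|+r)}\langle b,a^r\rangle a^1\cdots a^{r-1}$). $R=T(s^{-1}C)$ is the cobar construction of $k\oplus C$, with double bracket $\{\!\{r,q\}\!\}=\sum_{i,j}(-1)^{|v_i|+\epsilon}\langle v_i,w_j\rangle(s^{-1}w_1\cdots s^{-1}w_{j-1}s^{-1}v_{i+1}\cdots s^{-1}v_k)\otimes(s^{-1}v_1\cdots s^{-1}v_{i-1}s^{-1}w_{j+1}\cdots s^{-1}w_m)$ for $r=(s^{-1}v_1\cdots s^{-1}v_k)$, $q=(s^{-1}w_1\cdots s^{-1}w_m)$, $\epsilon=(|r|+d)\sum_{l<j}|s^{-1}w_l|+(\sum_{l<i}|s^{-1}v_l|+|s^{-1}w_j|+d)\sum_{l>i}|s^{-1}v_l|$,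 and $\{-,-\}=\mu\circ\{\!\{-,-\}\!\}$. $\Omega^1_R=\ker(R\otimes R\to R)\cong R\otimes s^{-1}C\otimes R$ via $\mathrm I(b\otimes x\otimes c)=bx\otimes c-b\otimes xc$; $\Omega^1_{R,\natural}=\Omega^1_R/[R,\Omega^1_R]\cong R\otimes s^{-1}C$. The universal derivation $\partial(x_1\cdots x_m)=\sum_i(x_1\cdots x_{i-1})\otimes x_i\otimes(x_{i+1}\cdots x_m)$ induces $\bar\partial(x_1\cdots x_m)=\sum_i(-1)^{(|x_1|+\cdots+|x_i|)(|x_{i+1}|+\cdots+|x_m|)}(x_{i+1}\cdots x_mx_1\cdots x_{i-1})\otimes x_i$, and $\beta((x_1\cdots x_m)\otimes x_{m+1})=x_1\cdots x_{m+1}-(-1)^{|x_{m+1}|(|x_1|+\cdots+|x_m|)}x_{m+1}x_1\cdots x_m$ ($x_i\in s^{-1}C$). On $R\otimes R$: $\{\!\{r,p\otimes q\}\!\}_{R\otimes R}=\{\!\{r,p\}\!\}\otimes q+(-1)^{|p|(|r|+n)}p\otimes\{\!\{r,q\}\!\}$; for $\omega\in\Omega^1_R$, $\{r,\omega\}_{\Omega^1_R}$ is obtained by applying the bimodule action map to $\{\!\{r,\mathrm I(\omega)\}\!\}_{R\otimes R}\in(R\otimes\Omega^1_R)\oplus(\Omega^1_R\otimes R)$, and $\{r,\omega\}_{\Omega^1_{R,\natural}}$ is its image in $\Omega^1_{R,\natural}$. *)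

(* Defs.v *)
(* with multinomials' monoid algebras {malg k[K]} used as
   free k-modules on a (choice) type K of basis vectors. *)
From HB Require Import structures.
From mathcomp Require Import all_boot all_order all_algebra.
From mathcomp Require Import finmap.
From mathcomp.multinomials Require Import monalg.

Set Implicit Arguments.
Unset Strict Implicit.
Unset Printing Implicit Defensive.

Import Order.TTheory GRing.Theory Num.Theory.
Local Open Scope ring_scope.

Section FreeModules.
Variable k : fieldType.

Definition lin (K : choiceType) (V : lmodType k) (F : K -> V)
    (x : {malg k[K]}) : V :=
  \sum_(u <- msupp x) x@_u *: F u.

Definition sgn (z : int) : k := (-1) ^+ `|z|%N.

End FreeModules.

Section Cobar.
(* The graded vector space C is presented by a homogeneous basis (e_i)_{i : I}
   with degrees deg i.  Words  seq I  index the basis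
   s^{-1}e_{i1} ... s^{-1}e_{im}  of R = T(s^{-1}C). *)
Variables (k : fieldType) (I : choiceType) (deg : I -> int).

Fixpoint splits (v : seq I) : seq (seq I * I * seq I) :=
  if v is x :: v' then
    ([::], x, v') :: [seq (x :: p.1.1, p.1.2, p.2) | p <- splits v']
  else [::].

(* |s^{-1} w_1 ... s^{-1} w_m| *)
Definition wdeg (w : seq I) : int := \sum_(x <- w) (deg x - 1).
(* degree in C^{(x) m} of w_1 (x) ... (x) w_m *)
Definition cdeg (w : seq I) : int := \sum_(x <- w) deg x.

Definition Rt := {malg k[seq I]}.
Definition RRt := {malg k[(seq I * seq I)%type]}.
Definition RRRt := {malg k[(seq I * seq I * seq I)%type]}.
Definition Omt := {malg k[(seq I * I * seq I)%type]}.      (* Omega^1_R = R (x) s^-1C (x) R *)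
Definition Omnt := {malg k[(seq I * I)%type]}.             (* Omega^1_{R,nat} = R (x) s^-1C *)

Variables (d : int) (g : I -> I -> k). (* g i j = <e_i, e_j> *)

Definition nn : int := 2 - d.

Definition dbw (v w : seq I) : RRt :=
  \sum_(s <- splits v) \sum_(t <- splits w)
    (sgn k (deg s.1.2 +
            ((wdeg v + d) * wdeg t.1.1
             + (wdeg s.1.1 + (deg t.1.2 - 1) + d) * wdeg s.2))
     * g s.1.2 t.1.2)
    *: << (t.1.1 ++ s.2, s.1.1 ++ t.2) >>.

Definition dbr (r q : Rt) : RRt := lin (fun v => lin (fun w => dbw v w) q) r.

Definition mu (x : RRt) : Rt := lin (fun p => << p.1 ++ p.2 >> : Rt) x.

Definition br (r q : Rt) : Rt := mu (dbr r q).

Definition dbRR (r : Rt) (x : RRt) : RRRt :=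
  lin (fun v => lin (fun pq =>
     lin (fun ab => << (ab.1, ab.2, pq.2) >> : RRRt) (dbw v pq.1)
   + sgn k (wdeg pq.1 * (wdeg v + nn))
       *: lin (fun ab => << (pq.1, ab.1, ab.2) >> : RRRt) (dbw v pq.2)) x) r.

(* the bimodule action maps (R (x) Omega^1_R) + (Omega^1_R (x) R) -> Omega^1_R,
   i.e. a (x) (b (x) c) |-> ab (x) c on the first summand and
   (a (x) b) (x) c |-> a (x) bc on the second; on the sum of the two
   subspaces this is the restriction of  mu (x) 1 + 1 (x) mu. *)
Definition actmap (x : RRRt) : RRt :=
  lin (fun t => << (t.1.1 ++ t.1.2, t.2) >> + << (t.1.1, t.1.2 ++ t.2) >> : RRt) x.

(* I : R (x) s^-1C (x) R -> Omega^1_R (subset of R (x) R) *)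
Definition Imap (x : Omt) : RRt :=
  lin (fun t => << (rcons t.1.1 t.1.2, t.2) >> - << (t.1.1, t.1.2 :: t.2) >> : RRt) x.

(* inverse of I on Omega^1_R = ker mu :  u (x) v |-> - u . partial(v) *)
Definition Jmap (x : RRt) : Omt :=
  lin (fun uv => - \sum_(s <- splits uv.2) << (uv.1 ++ s.1.1, s.1.2, s.2) >> : Omt) x.

Definition projn (x : Omt) : Omnt :=
  lin (fun t => sgn k ((wdeg t.1.1 + (deg t.1.2 - 1)) * wdeg t.2)
                 *: << (t.2 ++ t.1.1, t.1.2) >> : Omnt) x.

Definition liftn (x : Omnt) : Omt :=
  lin (fun t => << (t.1, t.2, [::]) >> : Omt) x.

Definition brOm (r : Rt) (om : Omt) : Omt := Jmap (actmap (dbRR r (Imap om))).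

Definition brOmn (r : Rt) (om : Omnt) : Omnt := projn (brOm r (liftn om)).

Definition dbar (x : Rt) : Omnt :=
  lin (fun w => \sum_(s <- splits w)
        sgn k (wdeg (rcons s.1.1 s.1.2) * wdeg s.2)
          *: << (s.2 ++ s.1.1, s.1.2) >> : Omnt) x.

Definition beta (x : Omnt) : Rt :=
  lin (fun t => << rcons t.1 t.2 >> - sgn k ((deg t.2 - 1) * wdeg t.1)
                                          *: << t.2 :: t.1 >> : Rt) x.

End Cobar.

Section AInfinity.
(* Delta n i = Delta_n(e_i) in C^{(x) n}, as a combination of words of length n *)
Variables (k : fieldType) (I : choiceType) (deg : I -> int)
          (Delta : nat -> I -> {malg k[seq I]}).

(* (1^{(x) r} (x) Delta_s (x) 1^{(x) t}) applied to an element of C^{(x) r+1+t},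
   with the Koszul sign (-1)^{(s-2)(|x_1|+...+|x_r|)} *)
Definition tensDelta (r s : nat) (x : {malg k[seq I]}) : {malg k[seq I]} :=
  lin (fun w => \sum_(p <- splits w | size p.1.1 == r)
         sgn k ((s%:Z - 2) * cdeg deg p.1.1)
           *: lin (fun m => << p.1.1 ++ m ++ p.2 >> : {malg k[seq I]})
                  (Delta s p.1.2)) x.

Definition is_Ainf_coalgebra : Prop :=
  (forall n i w, (0 < n)%N -> w \in msupp (Delta n i) -> size w = n) /\
  (forall n i w, (0 < n)%N -> w \in msupp (Delta n i) ->
      cdeg deg w = deg i + n%:Z - 2) /\
  (forall n i, (0 < n)%N ->
      \sum_(r < n) \sum_(s <- iota 1 (n - r))
        sgn k (r%:Z + s%:Z * (n - r - s)%N%:Z)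
          *: tensDelta r s (Delta (r + 1 + (n - r - s))%N i) = 0).

Variables (d : int) (g : I -> I -> k).

Definition is_cyclic_Ainf_coalgebra : Prop :=
  is_Ainf_coalgebra /\
  (forall z : int, exists s : seq I, forall i, deg i = z -> i \in s) /\
  (forall i j, g i j != 0 -> deg i + deg j = d) /\
  (forall i j, g i j = sgn k (deg i * deg j) * g j i) /\
  (forall c : {malg k[I]},
      (forall j, \sum_(x <- msupp c) c@_x * g x j = 0) -> c = 0) /\
  (* cyclicity: <a,b^1> b^2...b^r = (-1)^{r+|b^1|(|a|+r)} <b,a^r> a^1...a^{r-1} *)
  (forall (r : nat) (i j : I), (0 < r)%N ->
      lin (fun w => if w is x :: w' then
                      (sgn k (deg x * (deg i + r%:Z)) * g i x) *: << w' >>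
                    else 0 : {malg k[seq I]}) (Delta r j)
      = sgn k r%:Z *:
        lin (fun w => if w is y :: w' then g j (last y w') *: << belast y w' >>
                      else 0 : {malg k[seq I]}) (Delta r i)).

End AInfinity.

(* Main.v *)
(* For a word v, the map D = {v,-} is a derivation of T(s^-1 C) of parity
   e = |v| + d, because the pairing has degree d.  The bracket of v with
   b (x) x in Omega^1_{R,nat} is the class of the Lie derivative
   D(b) dx + (-1)^{e|b|} b d(Dx).  Both identities follow from how this operator
   acts on the classes c(b, w) of b dw, w a word, which obey
   c(b, uw) = +- c(wb, u) + c(bu, w):
     L c(b, w) = c(Db, w) + (-1)^{e|b|} c(b, Dw)   and
     beta c(b, w) = bw - (-1)^{|b||w|} wb,
   each by induction on w; the first at b = 1 is the claim for dbar, since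
   dbar w = c(1, w). *)
Require Import Defs.
From HB Require Import structures.
From mathcomp Require Import all_boot all_order all_algebra.
From mathcomp Require Import finmap.
From mathcomp.multinomials Require Import monalg.
From mathcomp Require Import zify.
Import GRing.Theory.
Set Implicit Arguments.
Unset Strict Implicit.
Local Open Scope ring_scope.

(** * Linear extension of maps given on a basis *)

Section LinearExtension.
Variable k : fieldType.
Implicit Types K L : choiceType.

(** Cancellation can make the support of a sum smaller than the union of the supports, so linearity
    of [lin] is checked with all sums taken over one common finite set. *)
Lemma linEw K (V : lmodType k) (F : K -> V) (x : {malg k[K]}) (A : {fset K}) :
  (msupp x `<=` A)%fset -> lin F x = \sum_(u <- A) x@_u *: F u.
Proof.
move=> sxA; rewrite /lin (big_fset_incl _ sxA) //= => u _ xu.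
by rewrite mcoeff_outdom // scale0r.
Qed.

Lemma lin_is_linear K (V : lmodType k) (F : K -> V) : linear (lin F).
Proof.
move=> a x y; pose A := (msupp x `|` msupp y)%fset.
rewrite (@linEw _ _ F (a *: x + y) A); last first.
  apply/fsubsetP => u; rewrite -mcoeff_neq0 mcoeffD mcoeffZ inE.
  by case: msuppP; case: msuppP => //; rewrite mulr0 addr0 eqxx.
rewrite (@linEw _ _ F x A) ?fsubsetUl // (@linEw _ _ F y A) ?fsubsetUr //.
rewrite scaler_sumr -big_split; apply: eq_bigr => u _ /=.
by rewrite mcoeffD mcoeffZ scalerDl scalerA.
Qed.

HB.instance Definition _ K (V : lmodType k) (F : K -> V) :=
  GRing.isLinear.Build k {malg k[K]} V *:%R (lin F) (@lin_is_linear K V F).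

Lemma linD K (V : lmodType k) (F : K -> V) : {morph lin F : x y / x + y}.
Proof. exact: linearD. Qed.

Lemma linN K (V : lmodType k) (F : K -> V) : {morph lin F : x / - x}.
Proof. exact: linearN. Qed.

Lemma linZ K (V : lmodType k) (F : K -> V) (a : k) (x : {malg k[K]}) :
  lin F (a *: x) = a *: lin F x.
Proof. exact: linearZ. Qed.

Lemma lin_sum K (V : lmodType k) (F : K -> V) (T : Type) (r : seq T)
    (G : T -> {malg k[K]}) :
  lin F (\sum_(i <- r) G i) = \sum_(i <- r) lin F (G i).
Proof. exact: linear_sum. Qed.

Lemma linU K (V : lmodType k) (F : K -> V) (u : K) : lin F << u >> = F u.
Proof. by rewrite /lin msuppU oner_eq0 big_seq_fset1 mcoeffUU scale1r. Qed.

Lemma eq_lin K (V : lmodType k) (F G : K -> V) (x : {malg k[K]}) :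
  F =1 G -> lin F x = lin G x.
Proof. by move=> eFG; apply: eq_bigr => u _; rewrite eFG. Qed.

Lemma linear_lin K (U V : lmodType k) (f : {linear U -> V}) (F : K -> U)
    (x : {malg k[K]}) :
  f (lin F x) = lin (fun u => f (F u)) x.
Proof. by rewrite /lin linear_sum; apply: eq_bigr => u _; rewrite linearZ. Qed.

Lemma lin_lin K L (V : lmodType k) (F : L -> V) (G : K -> {malg k[L]})
    (x : {malg k[K]}) :
  lin F (lin G x) = lin (fun u => lin F (G u)) x.
Proof. exact: (linear_lin (lin F)). Qed.

(** For [F] the inclusion of the basis, [lin F] is the identity. This turns equations between
    elements into equations between functionals, where no normal form in [{malg k[K]}] is needed. *)
Lemma lin_inj K (x y : {malg k[K]}) :
  (forall (V : lmodType k) (F : K -> V), lin F x = lin F y) -> x = y.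
Proof.
have lin_id (z : {malg k[K]}) : lin (fun u => << u >> : {malg k[K]}) z = z.
  apply/malgP => u; rewrite [in RHS](monalgE z) /lin !raddf_sum.
  by apply: eq_bigr => w _; rewrite /= mcoeffZ !mcoeffU mulr_natr.
by move=> exy; rewrite -[x]lin_id exy lin_id.
Qed.

End LinearExtension.

(** * Signs and parities *)

Definition par (z : int) : bool := odd `|z|%N.

Lemma parD (a b : int) : par (a + b) = par a (+) par b.
Proof. rewrite /par; lia. Qed.

Lemma parM (a b : int) : par (a * b) = par a && par b.
Proof. by rewrite /par abszM oddM. Qed.

Lemma parN (a : int) : par (- a) = par a.
Proof. by rewrite /par abszN. Qed.

Lemma par0 : par 0 = false.
Proof. by []. Qed.

Lemma sgn_par (k : fieldType) (z : int) : sgn k z = (-1) ^+ par z.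
Proof. by rewrite /sgn signr_odd. Qed.

Lemma eq_sgn (k : fieldType) (a b : int) : par a = par b -> sgn k a = sgn k b.
Proof. by rewrite !sgn_par => ->. Qed.

Lemma sgnD (k : fieldType) (a b : int) : sgn k (a + b) = sgn k a * sgn k b.
Proof. by rewrite !sgn_par parD signr_addb. Qed.

(* Otherwise unification unfolds the algebraic structure of {malg k[_]}. *)
Local Opaque lin sgn mkmalgU par.

(** * Degrees of words and sums over a marked letter *)

Section Words.
Context {I : choiceType}.
Variable (deg : I -> int).

Lemma wdeg_nil : wdeg deg [::] = 0.
Proof. exact: big_nil. Qed.

Lemma wdeg_cons (x : I) (w : seq I) : wdeg deg (x :: w) = (deg x - 1) + wdeg deg w.
Proof. exact: big_cons. Qed.

Lemma wdeg_cat (u w : seq I) : wdeg deg (u ++ w) = wdeg deg u + wdeg deg w.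
Proof. exact: big_cat. Qed.

Lemma wdeg_rcons (w : seq I) (x : I) : wdeg deg (rcons w x) = wdeg deg w + (deg x - 1).
Proof. by rewrite -cats1 wdeg_cat wdeg_cons wdeg_nil addr0. Qed.

Lemma splits_wdeg (w : seq I) s : s \in splits w ->
  wdeg deg w = wdeg deg s.1.1 + (deg s.1.2 - 1) + wdeg deg s.2.
Proof.
elim: w s => //= x w IH s; rewrite inE => /orP[/eqP ->|/mapP[t tw ->]] /=.
  by rewrite wdeg_nil wdeg_cons add0r.
by rewrite !wdeg_cons (IH t tw) !addrA.
Qed.

Lemma big_splits_cons (V : nmodType) (F : seq I * I * seq I -> V) (x : I) (w : seq I) :
  \sum_(s <- splits (x :: w)) F s =
  F ([::], x, w) + \sum_(s <- splits w) F (x :: s.1.1, s.1.2, s.2).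
Proof. by rewrite /= big_cons big_map. Qed.

(** The marked letter lies in [u] or in [w]; this is the source of every Leibniz rule below. *)
Lemma big_splits_cat (V : nmodType) (F : seq I * I * seq I -> V) (u w : seq I) :
  \sum_(s <- splits (u ++ w)) F s =
  \sum_(s <- splits u) F (s.1.1, s.1.2, s.2 ++ w) +
  \sum_(s <- splits w) F (u ++ s.1.1, s.1.2, s.2).
Proof.
elim: u F => [|x u IH] F.
  by rewrite big_nil add0r; apply: eq_bigr => -[[? ?] ?].
by rewrite cat_cons !big_splits_cons IH -addrA.
Qed.

End Words.

(** On parities, addition is exclusive or, multiplication is conjunction and negation is trivial, so
    a sign identity becomes a propositional tautology, checked by enumeration. *)
Ltac par_cases :=
  rewrite ?(wdeg_cat, wdeg_rcons, wdeg_cons, wdeg_nil, parD, parM, parN, par0) /=;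
  repeat match goal with |- context [par ?z] => generalize (par z) end;
  clear; repeat case=> //.

(** * The double bracket with a fixed word and the derivation D it induces *)

Section Derivation.
Context {k : fieldType} {I : choiceType}.
Variables (deg : I -> int) (d : int) (g : I -> I -> k).
Hypothesis g_deg : forall i j, g i j != 0 -> deg i + deg j = d.
Variable v : seq I.
Local Notation wdeg := (wdeg deg).
Local Notation e := (wdeg v + d).

(* An element x of a free module is handled through its values [lin F x] under
   maps F from the basis to an arbitrary module V: [dbf F w], [derf F w],
   [cycf H b w] and [lief H (b, x)] are the values of {{v, w}}, of {v, w}, of the
   class of b dw in Omega^1_{R,nat}, and of {v, b (x) x}. *)
Section Functionals.
Variable V : lmodType k.
Implicit Types (F G : seq I -> V) (H : seq I * I -> V).

Definition dbf (F : seq I * seq I -> V) (w : seq I) : V :=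
  \sum_(s <- splits v) \sum_(t <- splits w)
    (sgn k (deg s.1.2 + (e * wdeg t.1.1
              + (wdeg s.1.1 + (deg t.1.2 - 1) + d) * wdeg s.2))
     * g s.1.2 t.1.2)
    *: F (t.1.1 ++ s.2, s.1.1 ++ t.2).

Lemma dbf_nil (F : seq I * seq I -> V) : dbf F [::] = 0.
Proof. by rewrite /dbf big1 // => s _; rewrite big_nil. Qed.

(** A nonzero pairing forces the two contracted letters to have degrees adding up to [d]. Every term
    that survives thus has the parity of [w] shifted by [e], and only there need [F] and [F']
    agree. *)
Lemma eq_dbf_par (F F' : seq I * seq I -> V) (w : seq I) :
    (forall a b, par (wdeg (a ++ b)) = par (wdeg w + e) -> F (a, b) = F' (a, b)) ->
  dbf F w = dbf F' w.
Proof.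
move=> eF; rewrite /dbf; apply: eq_big_seq => -[[s1 x] s2] sv.
apply: eq_big_seq => -[[t1 y] t2] tw /=.
have [->|/g_deg Hg] := eqVneq (g x y) 0; first by rewrite mulr0 !scale0r.
rewrite eF // -{1}Hg (splits_wdeg deg sv) (splits_wdeg deg tw) /=.
by par_cases.
Qed.

Lemma eq_dbf (F F' : seq I * seq I -> V) (w : seq I) :
  F =1 F' -> dbf F w = dbf F' w.
Proof.
by move=> eF; apply: eq_bigr => s _; apply: eq_bigr => t _; rewrite eF.
Qed.

Lemma dbf0 (w : seq I) : dbf (fun=> 0) w = 0.
Proof.
by rewrite /dbf big1 // => s _; rewrite big1 // => t _; rewrite scaler0.
Qed.

Lemma dbfD (F F' : seq I * seq I -> V) (w : seq I) :
  dbf (fun p => F p + F' p) w = dbf F w + dbf F' w.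
Proof.
rewrite /dbf -big_split; apply: eq_bigr => s _ /=.
by rewrite -big_split; apply: eq_bigr => t _ /=; rewrite scalerDr.
Qed.

Lemma dbfZ (a : k) (F : seq I * seq I -> V) (w : seq I) :
  dbf (fun p => a *: F p) w = a *: dbf F w.
Proof.
rewrite /dbf scaler_sumr; apply: eq_bigr => s _ /=.
by rewrite scaler_sumr; apply: eq_bigr => t _ /=; rewrite !scalerA mulrC.
Qed.

Lemma dbfN (F : seq I * seq I -> V) (w : seq I) :
  dbf (fun p => - F p) w = - dbf F w.
Proof.
by rewrite -scaleN1r -dbfZ; apply: eq_dbf => p; rewrite scaleN1r.
Qed.

(** Leibniz rule for the outer bimodule structure: [b] multiplies the second tensor factor from the
    right, [a] the first one from the left. *)
Lemma dbf_cat (F : seq I * seq I -> V) (a b : seq I) :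
  dbf F (a ++ b) = dbf (fun p => F (p.1, p.2 ++ b)) a
    + sgn k (e * wdeg a) *: dbf (fun p => F (a ++ p.1, p.2)) b.
Proof.
rewrite /dbf scaler_sumr -big_split; apply: eq_bigr => s _ /=.
rewrite big_splits_cat scaler_sumr; congr (_ + _).
  by apply: eq_bigr => t _ /=; rewrite catA.
apply: eq_bigr => t _ /=; rewrite scalerA catA mulrA -sgnD.
by congr (_ * _ *: _); apply: eq_sgn; par_cases.
Qed.

Definition derf F (w : seq I) : V := dbf (fun p => F (p.1 ++ p.2)) w.

Lemma eq_derf_par F G (w : seq I) :
    (forall u, par (wdeg u) = par (wdeg w + e) -> F u = G u) ->
  derf F w = derf G w.
Proof. by move=> eF; apply: eq_dbf_par => a b /eF. Qed.

Lemma eq_derf F G (w : seq I) : F =1 G -> derf F w = derf G w.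
Proof. by move=> eF; apply: eq_dbf => p. Qed.

Lemma derf_nil F : derf F [::] = 0.
Proof. exact: dbf_nil. Qed.

Lemma derf0 (w : seq I) : derf (fun=> 0) w = 0.
Proof. exact: dbf0. Qed.

Lemma derfD F G (w : seq I) : derf (fun u => F u + G u) w = derf F w + derf G w.
Proof. exact: dbfD. Qed.

Lemma derfZ (a : k) F (w : seq I) : derf (fun u => a *: F u) w = a *: derf F w.
Proof. exact: dbfZ. Qed.

Lemma derf_cat F (a b : seq I) :
  derf F (a ++ b) = derf (fun u => F (u ++ b)) a
    + sgn k (e * wdeg a) *: derf (fun u => F (a ++ u)) b.
Proof.
rewrite /derf dbf_cat; congr (_ + _ *: _); apply: eq_dbf => p /=;
  by rewrite catA.
Qed.

(** * Classes of b dw under beta and under the Lie derivative L *)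

Definition cycf H (b w : seq I) : V :=
  \sum_(s <- splits w) sgn k ((wdeg (b ++ s.1.1) + (deg s.1.2 - 1)) * wdeg s.2)
     *: H (s.2 ++ b ++ s.1.1, s.1.2).

Lemma cycf_nil H (b : seq I) : cycf H b [::] = 0.
Proof. exact: big_nil. Qed.

(** From b d(uw) = b (du) w + bu dw: modulo commutators the trailing w of the first term rotates to
    the front, with its Koszul sign. *)
Lemma cycf_cat H (b u w : seq I) :
  cycf H b (u ++ w) =
  sgn k (wdeg (b ++ u) * wdeg w) *: cycf H (w ++ b) u + cycf H (b ++ u) w.
Proof.
rewrite /cycf big_splits_cat scaler_sumr; congr (_ + _); last first.
  by apply: eq_bigr => s _ /=; rewrite catA.
apply: eq_big_seq => -[[s1 x] s2] su /=; rewrite scalerA -sgnD !catA.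
congr (_ *: _); apply: eq_sgn.
by rewrite !wdeg_cat (splits_wdeg deg su); par_cases.
Qed.

Lemma cycf1 H (b : seq I) (x : I) : cycf H b [:: x] = H (b, x).
Proof.
by rewrite /cycf big_splits_cons big_nil addr0 /= cats0 wdeg_nil mulr0 scale1r.
Qed.

Definition betaf F (t : seq I * I) : V :=
  F (rcons t.1 t.2) - sgn k ((deg t.2 - 1) * wdeg t.1) *: F (t.2 :: t.1).

(** The sum telescopes: splitting off the first letter x of the word, the term wbx occurs in both
    parts with opposite signs. *)
Lemma cycf_betaf F (b w : seq I) :
  cycf (betaf F) b w = F (b ++ w) - sgn k (wdeg b * wdeg w) *: F (w ++ b).
Proof.
elim: w b => [|x w IH] b.
  by rewrite cycf_nil wdeg_nil mulr0 cats0 scale1r subrr.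
rewrite -cat1s cycf_cat cycf1 IH /betaf /= -cats1 scalerBr scalerA -sgnD -!catA.
rewrite addrC addrA wdeg_cat addrNK; congr (_ - _ *: _).
by apply: eq_sgn; par_cases.
Qed.

Definition lief H (t : seq I * I) : V :=
  derf (fun u => H (u, t.2)) t.1 + sgn k (e * wdeg t.1) *: derf (cycf H t.1) [:: t.2].

(** Induction on [w], splitting off its first letter x: [cycf_cat] separates x from the rest, and
    the Leibniz rule for D is applied to each resulting word. *)
Lemma cycf_lief H (b w : seq I) :
  cycf (lief H) b w =
  derf (fun u => cycf H u w) b + sgn k (e * wdeg b) *: derf (cycf H b) w.
Proof.
elim: w b => [|x w IH] b.
  rewrite cycf_nil derf_nil scaler0 addr0.
  by rewrite (eq_derf b (fun u => cycf_nil H u)) derf0.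
rewrite -cat1s cycf_cat cycf1 IH /lief /=.
(* The sign from [cycf_cat] depends on the degree of u, but by [eq_derf_par] its parity is constant
   on the terms of D(b), so it leaves the sum. The same is done for D(x) and D(w) below. *)
have -> : derf (fun u => cycf H u (x :: w)) b =
    sgn k ((wdeg b + e + (deg x - 1)) * wdeg w) *: derf (fun u => H (w ++ u, x)) b
    + derf (fun u => cycf H (u ++ [:: x]) w) b.
  rewrite -derfZ -derfD; apply: eq_derf_par => u pu.
  rewrite -cat1s cycf_cat cycf1; congr (_ *: _ + _); apply: eq_sgn.
  by move: pu; par_cases.
rewrite -[x :: w]cat1s !derf_cat.
have -> : derf (fun u => cycf H b (u ++ w)) [:: x] =
    sgn k ((wdeg b + (deg x - 1) + e) * wdeg w) *: derf (cycf H (w ++ b)) [:: x]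
    + derf (fun u => cycf H (b ++ u) w) [:: x].
  rewrite -derfZ -derfD; apply: eq_derf_par => u pu.
  rewrite cycf_cat; congr (_ *: _ + _); apply: eq_sgn.
  by move: pu; par_cases.
have -> : derf (fun u => cycf H b ([:: x] ++ u)) w =
    sgn k ((wdeg b + (deg x - 1)) * (wdeg w + e)) *: derf (fun u => H (u ++ b, x)) w
    + derf (cycf H (b ++ [:: x])) w.
  rewrite -derfZ -derfD; apply: eq_derf_par => u pu.
  rewrite cycf_cat cycf1; congr (_ *: _ + _); apply: eq_sgn.
  by move: pu; par_cases.
rewrite !scalerDr !scalerA -!sgnD.
(* The six terms are paired according to whether D falls on b, on x or on w. *)
rewrite [LHS](AC (3*3) ((2*4)*((3*5)*(1*6))))%AC.
by congr ((_ *: _ + _) + ((_ *: _ + _) + (_ *: _ + _ *: _))); apply: eq_sgn;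
  par_cases.
Qed.

(** Functionals compose in reverse order: the left side evaluates [F] on beta of the bracket, the
    right side on D of beta. Both are D applied to bx and to xb. *)
Lemma lief_betaf F (t : seq I * I) :
  lief (betaf F) t = betaf (derf F) t.
Proof.
case: t => b x; rewrite /lief /=.
have -> : derf (fun u => betaf F (u, x)) b =
    derf (fun u => F (u ++ [:: x])) b
    - sgn k ((deg x - 1) * (wdeg b + e)) *: derf (fun u => F ([:: x] ++ u)) b.
  rewrite -scaleNr -derfZ -derfD; apply: eq_derf_par => u pu.
  rewrite /betaf -cats1 scaleNr; congr (_ - _ *: _); apply: eq_sgn.
  by move: pu; par_cases.
have -> : derf (cycf (betaf F) b) [:: x] =
    derf (fun u => F (b ++ u)) [:: x]
    - sgn k (wdeg b * (deg x - 1 + e)) *: derf (fun u => F (u ++ b)) [:: x].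
  rewrite -scaleNr -derfZ -derfD; apply: eq_derf_par => u pu.
  rewrite cycf_betaf scaleNr; congr (_ - _ *: _); apply: eq_sgn.
  by move: pu; par_cases.
rewrite /betaf /= -cats1 -[x :: b]cat1s !derf_cat.
rewrite scalerBr scalerDr !scalerA -!sgnD opprD.
(* Terms 1 and 3 form D(bx), terms 4 and 2 form D(xb). *)
rewrite [LHS](AC (2*2) ((1*3)*(4*2)))%AC.
by congr (_ + _ + (- (_ *: _) - _ *: _)); apply: eq_sgn; par_cases.
Qed.

Lemma lin_dbw (F : seq I * seq I -> V) (w : seq I) :
  lin F (dbw deg d g v w) = dbf F w.
Proof.
rewrite /dbw lin_sum; apply: eq_bigr => s _.
by rewrite lin_sum; apply: eq_bigr => t _; rewrite linZ linU.
Qed.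

End Functionals.

End Derivation.

Local Opaque dbw.

(** * Values of the defined operations under an arbitrary functional *)

Section Evaluation.
Context {k : fieldType} {I : choiceType}.
Variables (deg : I -> int) (d : int) (g : I -> I -> k).
Local Notation wdeg := (wdeg deg).
Variable V : lmodType k.
Implicit Types (F : seq I -> V) (H : seq I * I -> V).

Lemma lin_br F (r q : Rt k I) :
  lin F (br deg d g r q) = lin (fun v => lin (derf deg d g v F) q) r.
Proof.
rewrite /br /mu lin_lin /dbr lin_lin; apply: eq_lin => v.
rewrite lin_lin; apply: eq_lin => w.
by rewrite lin_dbw /derf; apply: eq_bigr => s _; apply: eq_bigr => t _; rewrite linU.
Qed.

Lemma lin_dbar H (x : Rt k I) :
  lin H (dbar deg x) = lin (cycf deg H [::]) x.
Proof.
rewrite /dbar lin_lin; apply: eq_lin => w; rewrite lin_sum.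
by apply: eq_bigr => s _; rewrite linZ linU /= wdeg_rcons.
Qed.

Lemma lin_beta F (x : Omnt k I) :
  lin F (beta deg x) = lin (betaf deg F) x.
Proof.
rewrite /beta lin_lin; apply: eq_lin => t.
by rewrite linD linN linZ !linU.
Qed.

Lemma lin_Imap (F : seq I * seq I -> V) (x : Omt k I) :
  lin F (Imap x) =
  lin (fun t => F (rcons t.1.1 t.1.2, t.2) - F (t.1.1, t.1.2 :: t.2)) x.
Proof. by rewrite /Imap lin_lin; apply: eq_lin => t; rewrite linD linN !linU. Qed.

Lemma lin_liftn (F : seq I * I * seq I -> V) (x : Omnt k I) :
  lin F (liftn x) = lin (fun t => F (t.1, t.2, [::])) x.
Proof. by rewrite /liftn lin_lin; apply: eq_lin => t; rewrite linU. Qed.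

Lemma lin_actmap (F : seq I * seq I -> V) (x : RRRt k I) :
  lin F (actmap x) =
  lin (fun t => F (t.1.1 ++ t.1.2, t.2) + F (t.1.1, t.1.2 ++ t.2)) x.
Proof. by rewrite /actmap lin_lin; apply: eq_lin => t; rewrite linD !linU. Qed.

(** The inverse of I sends p (x) q to -p dq, so its class is minus the one computed by [cycf]. *)
Lemma lin_projn_Jmap H (x : RRt k I) :
  lin H (projn deg (Jmap x)) = lin (fun p => - cycf deg H p.1 p.2) x.
Proof.
rewrite /projn lin_lin /Jmap lin_lin; apply: eq_lin => p.
rewrite linN lin_sum; congr (- _); apply: eq_bigr => s _.
by rewrite linU linZ linU.
Qed.

Lemma lin_dbRR (F : seq I * seq I * seq I -> V) (r : Rt k I) (x : RRt k I) :
  lin F (dbRR deg d g r x) =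
  lin (fun v => lin (fun p =>
    dbf deg d g v (fun ab => F (ab.1, ab.2, p.2)) p.1
    + sgn k (wdeg p.1 * (wdeg v + nn d))
        *: dbf deg d g v (fun ab => F (p.1, ab.1, ab.2)) p.2) x) r.
Proof.
rewrite /dbRR lin_lin; apply: eq_lin => v; rewrite lin_lin; apply: eq_lin => p.
have lin_dbwU (G : seq I * seq I -> seq I * seq I * seq I) (w : seq I) :
    lin F (lin (fun ab => << G ab >> : RRRt k I) (dbw deg d g v w))
    = dbf deg d g v (fun ab => F (G ab)) w.
  by rewrite lin_lin -lin_dbw; apply: eq_lin => ab; rewrite linU.
rewrite linD linZ; apply: f_equal2.
  exact: (lin_dbwU (fun ab => (ab.1, ab.2, p.2))).
apply: f_equal; exact: (lin_dbwU (fun ab => (p.1, ab.1, ab.2))).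
Qed.

(** Here I(b (x) x (x) 1) = bx (x) 1 - b (x) x. Bracketing with v and applying the action map gives,
    besides the two terms of [lief], contributions of {{v,b}}x and b{{v,x}} that each occur twice
    with opposite signs. *)
Lemma lin_brOmn H (r : Rt k I) (om : Omnt k I) :
  lin H (brOmn deg d g r om) = lin (fun v => lin (lief deg d g v H) om) r.
Proof.
rewrite /brOmn /brOm lin_projn_Jmap lin_actmap lin_dbRR; apply: eq_lin => v.
rewrite lin_Imap lin_liftn; apply: eq_lin => -[b x] /=.
(* {{v,1}} = 0 removes one term, and {{v,bx}} is expanded by the Leibniz rule. *)
rewrite -cats1 dbf_nil scaler0 addr0 dbf_cat /=.
rewrite !dbfD !dbfN.
have cyc0 (f : seq I * seq I -> seq I) w :
    dbf deg d g v (fun p => cycf deg H (f p) [::]) w = 0.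
  by rewrite -[RHS](dbf0 deg d g v V w); apply: eq_dbf => p; apply: cycf_nil.
have cats (f h : seq I * seq I -> seq I) w :
    dbf deg d g v (fun p => cycf deg H (f p) (h p ++ [::])) w =
    dbf deg d g v (fun p => cycf deg H (f p) (h p)) w.
  by apply: eq_dbf => p; rewrite cats0.
have cyc1 (f : seq I * seq I -> seq I) w :
    dbf deg d g v (fun p => cycf deg H (f p) [:: x]) w =
    dbf deg d g v (fun p => H (f p, x)) w.
  by apply: eq_dbf => p; apply: cycf1.
rewrite !cyc0 !cats cyc1.
rewrite /lief /=.
(* 2 - d and d have the same parity. *)
have -> : sgn k (wdeg b * (wdeg v + nn d)) = sgn k ((wdeg v + d) * wdeg b).
  by apply: eq_sgn; rewrite /nn; par_cases.
rewrite !(oppr0, add0r) scalerBr !scalerN !opprD !opprK.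
(* Terms 3 and 6 are D(b) dx and b d(Dx); the pairs 1, 4 and 2, 5 cancel. *)
by rewrite [LHS](AC (2*(2*2)) ((3*6)*((1*4)*(2*5))))%AC /= !addNr !addr0.
Qed.

End Evaluation.

Unset Implicit Arguments.

Theorem theorem5p4 (k : fieldType) (I : choiceType) (deg : I -> int)
    (Delta : nat -> I -> {malg k[seq I]}) (d : int) (g : I -> I -> k) :
  is_cyclic_Ainf_coalgebra deg Delta d g ->
  (forall r q : Rt k I,
      dbar deg (br deg d g r q) = brOmn deg d g r (dbar deg q)) /\
  (forall (r : Rt k I) (om : Omnt k I),
      beta deg (brOmn deg d g r om) = br deg d g r (beta deg om)).
Proof.
case=> _ [_ [g_deg _]]; split=> [r q|r om]; apply: lin_inj => V F.
  rewrite lin_dbar lin_br lin_brOmn; apply: eq_lin => v.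
  rewrite lin_dbar; apply: eq_lin => w.
  by rewrite cycf_lief // derf_nil wdeg_nil mulr0 scale1r add0r.
rewrite lin_beta lin_brOmn lin_br; apply: eq_lin => v.
by rewrite lin_beta; apply: eq_lin => t; rewrite lief_betaf.
Qed.
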